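(* Let $C=\{c_1,\dots,c_n\}$ be a set of decision criteria with $c_b$ and $c_w$ as the best and the worst criterion respectively, let $(\tilde A_b,\tilde A_w)$ be a fuzzy pairwise comparison system (FPCS), let $F$ be a finite subset of $[0,1]$, and let $w_{i_0}'$ and $w_{i_0}''$ be defuzzified approximate optimal weights of criterion $c_{i_0}$ corresponding to $F$, for some $i_0\in\{1,\dots,n\}$, such that $w_{i_0}'<w_{i_0}''$. Then each $w_{i_0}\in[w_{i_0}',w_{i_0}'']$ is a defuzzified approximate optimal weight of $c_{i_0}$ corresponding to $F$.
   Context: A triangular fuzzy number (TFN) $(a,c,d)$, $a\le c\le d$, has $\alpha$-cuts $[a+\alpha(c-a),\,d-\alpha(d-c)]$ for $\alpha\in[0,1]$ ($\alpha=0$ standing for the support), and its graded mean integration representation (defuzzification) is $R((a,c,d))=\frac{a+4c+d}{6}$. The scale is $\tilde 1=(1,1,1)$, $\tilde k=(k-1,k,k+1)$ for $k=2,\dots,8$, $\tilde 9=(9,9,9)$. With $b\neq w$, an FPCS $(\tilde A_b,\tilde A_w)$ consists of $\tilde A_b=(\tilde a_{b1},\dots,\tilde a_{bn})$ and $\tilde A_w=(\tilde a_{1w},\dots,\tilde a_{nw})^T$, whose entries are TFNs from the scale, with $\tilde a_{bb}=\tilde a_{ww}=\tilde 1$ and common entry $\tilde a_{bw}$. The $\alpha$-cuts of the entries are written $[a_{ij}^l(\alpha),a_{ij}^u(\alpha)]$. For a finite $F\subset[0,1]$, consider the problem (O): minimize $\epsilon_F$ over $\epsilon_F$ and TFNs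 $\tilde w_q=(w_q^l,w_q^m,w_q^u)$, $q=1,\dots,n$, subject to, for all $i\in\{1,\dots,n\}\setminus\{b,w\}$ and all $\alpha\in F$, $|\frac{w_b^l(\alpha)}{w_i^u(\alpha)}-a_{bi}^l(\alpha)|\le\epsilon_F$, $|\frac{w_b^u(\alpha)}{w_i^l(\alpha)}-a_{bi}^u(\alpha)|\le\epsilon_F$, $|\frac{w_i^l(\alpha)}{w_w^u(\alpha)}-a_{iw}^l(\alpha)|\le\epsilon_F$, $|\frac{w_i^u(\alpha)}{w_w^l(\alpha)}-a_{iw}^u(\alpha)|\le\epsilon_F$, $|\frac{w_b^l(\alpha)}{w_w^u(\alpha)}-a_{bw}^l(\alpha)|\le\epsilon_F$, $|\frac{w_b^u(\alpha)}{w_w^l(\alpha)}-a_{bw}^u(\alpha)|\le\epsilon_F$, where $w_q^l(\alpha)=w_q^l+\alpha(w_q^m-w_q^l)$ and $w_q^u(\alpha)=w_q^u-\alpha(w_q^u-w_q^m)$, and $0\le w_q^l\le w_q^m\le w_q^u$ for all $q$, and $\sum_{q=1}^nR(\tilde w_q)=1$ (all denominators are understood to be positive). A family $\{\tilde w_1,\dots,\tilde w_n\}$ attaining the optimal value of (O) is an approximate optimal weight set corresponding to $F$. A real number $v$ is a defuzzified approximate optimal weight of $c_k$ corresponding to $F$ if $v=R(\tilde w_k)$ for some approximate optimal weight set $\{\tilde w_1,\dots,\tilde w_n\}$ corresponding to $F$. *)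

(* Defs.v *)
From HB Require Import structures.
From mathcomp Require Import all_boot all_order all_algebra.
From mathcomp Require Import all_classical.
From mathcomp Require Import reals.
Set Implicit Arguments.
Unset Strict Implicit.
Unset Printing Implicit Defensive.
Import Order.TTheory GRing.Theory Num.Theory.
Local Open Scope ring_scope.

Record tfn (R : realType) := Tfn {
  tfn_l : R;
  tfn_m : R;
  tfn_u : R;
  tfn_leP : tfn_l <= tfn_m <= tfn_u
}.

Definition cut_l (R : realType) (t : tfn R) (alpha : R) : R :=
  tfn_l t + alpha * (tfn_m t - tfn_l t).

Definition cut_u (R : realType) (t : tfn R) (alpha : R) : R :=
  tfn_u t - alpha * (tfn_u t - tfn_m t).

(* Graded mean integration representation. *)
Definition gmir (R : realType) (t : tfn R) : R :=
  (tfn_l t + 4 * tfn_m t + tfn_u t) / 6.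

Lemma crisp_subproof (R : realType) (x : R) : x <= x <= x.
Proof. by rewrite lexx. Qed.

Definition crisp (R : realType) (x : R) : tfn R := Tfn (crisp_subproof x).

Lemma around_subproof (R : realType) (x : R) : x - 1 <= x <= x + 1.
Proof. by rewrite lerBlDr lerDl ler01. Qed.

Definition around (R : realType) (x : R) : tfn R := Tfn (around_subproof x).

(* Only the values at 1 <= k <= 9 are meaningful; see [on_scale]. *)
Definition scale (R : realType) (k : nat) : tfn R :=
  if (k == 1%N) || (k == 9%N) then crisp k%:R else around k%:R.

Definition on_scale (R : realType) (t : tfn R) : Prop :=
  exists2 k : nat, (1 <= k <= 9)%N & t = scale R k.

(* Fuzzy pairwise comparison system with best criterion b and worst criterion
   w: best_to i compares b with i, to_worst i compares i with w. *)
Record fpcs (R : realType) (n : nat) (b w : 'I_n) := Fpcs {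
  best_to : 'I_n -> tfn R;
  to_worst : 'I_n -> tfn R;
  best_to_scale : forall i, on_scale (best_to i);
  to_worst_scale : forall i, on_scale (to_worst i);
  best_to_best : best_to b = scale R 1;
  worst_to_worst : to_worst w = scale R 1;
  best_to_worst : best_to w = to_worst b
}.

(* Division by 0 is total here, so the implicit requirement that the
   denominator be positive is part of the constraint. *)
Definition ratio_close (R : realType) (x y a eps : R) : Prop :=
  0 < y /\ `|x / y - a| <= eps.

(* The pair (eps, x) is feasible for problem (O): minimize eps over the real
   number eps and the family x of triangular fuzzy weights. The constraints
   comparing b with w do not involve i, hence are imposed even when n = 2. *)
Record feasible (R : realType) (n : nat) (b w : 'I_n) (A : fpcs R b w)
    (F : set R) (eps : R) (x : 'I_n -> tfn R) : Prop := Feasible {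
  feasible_best_l : forall i, i != b -> i != w -> forall alpha, F alpha ->
    ratio_close (cut_l (x b) alpha) (cut_u (x i) alpha)
                (cut_l (best_to A i) alpha) eps;
  feasible_best_u : forall i, i != b -> i != w -> forall alpha, F alpha ->
    ratio_close (cut_u (x b) alpha) (cut_l (x i) alpha)
                (cut_u (best_to A i) alpha) eps;
  feasible_worst_l : forall i, i != b -> i != w -> forall alpha, F alpha ->
    ratio_close (cut_l (x i) alpha) (cut_u (x w) alpha)
                (cut_l (to_worst A i) alpha) eps;
  feasible_worst_u : forall i, i != b -> i != w -> forall alpha, F alpha ->
    ratio_close (cut_u (x i) alpha) (cut_l (x w) alpha)
                (cut_u (to_worst A i) alpha) eps;
  feasible_bw_l : forall alpha, F alpha ->
    ratio_close (cut_l (x b) alpha) (cut_u (x w) alpha)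
                (cut_l (best_to A w) alpha) eps;
  feasible_bw_u : forall alpha, F alpha ->
    ratio_close (cut_u (x b) alpha) (cut_l (x w) alpha)
                (cut_u (best_to A w) alpha) eps;
  feasible_ge0 : forall q, 0 <= tfn_l (x q);
  feasible_sum : \sum_(q < n) gmir (x q) = 1
}.

Definition optimal_value (R : realType) (n : nat) (b w : 'I_n)
    (A : fpcs R b w) (F : set R) (eps : R) : Prop :=
  (exists x, feasible A F eps x) /\
  (forall eps' x', feasible A F eps' x' -> eps <= eps').

Definition approx_optimal_weight_set (R : realType) (n : nat) (b w : 'I_n)
    (A : fpcs R b w) (F : set R) (x : 'I_n -> tfn R) : Prop :=
  exists2 eps, optimal_value A F eps & feasible A F eps x.

Definition defuzz_approx_optimal_weight (R : realType) (n : nat) (b w : 'I_n)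
    (A : fpcs R b w) (F : set R) (k : 'I_n) (v : R) : Prop :=
  exists2 x, approx_optimal_weight_set A F x & v = gmir (x k).

(* Main.v *)
Require Import Defs.
From mathcomp Require Import all_boot all_order all_algebra.
From mathcomp Require Import all_classical.
From mathcomp Require Import reals.
From mathcomp Require Import ring.
Import Order.TTheory GRing.Theory Num.Theory.
Local Open Scope ring_scope.
Local Open Scope classical_set_scope.

(** Once the bound [eps] is fixed and the denominators are positive, the
    constraint [`|x / y - a| <= eps] is the pair of inequalities
    [(a - eps) * y <= x <= (a + eps) * y], linear in [(x, y)]
    ([ratio_closeE]). The alpha-cut endpoints and the graded mean integration
    representation are linear in the vertices of a fuzzy weight, so the set of
    weight families that are feasible for a given [eps] is convex
    ([feasible_mix]). Any two approximate optimal weight sets are feasible for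
    the same [eps], namely the optimal value, so the segment between them
    consists of approximate optimal weight sets. Along that segment the
    defuzzified weight of a criterion is affine, hence takes every value
    between those at the two ends. *)

(** Clearing the positive denominator turns the nonlinear constraint into one
    that is preserved by convex combinations of numerators and denominators. *)
Lemma ratio_closeE {R : realType} (x y a eps : R) :
  ratio_close x y a eps <->
  0 < y /\ (a - eps) * y <= x <= (a + eps) * y.
Proof.
by split=> -[y0 h]; split=> //; move: h;
  rewrite ler_distl ler_pdivlMr // ler_pdivrMr.
Qed.

Section Mix.

Context {R : realType} {t : R} (ht : 0 <= t <= 1).

Lemma mix_subproof (x y : tfn R) :
  (1 - t) * tfn_l x + t * tfn_l y <= (1 - t) * tfn_m x + t * tfn_m y
    <= (1 - t) * tfn_u x + t * tfn_u y.
Proof.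
case/andP: ht => t0 t1.
have s0 : 0 <= 1 - t by rewrite subr_ge0.
case/andP: (tfn_leP x) => xl xu; case/andP: (tfn_leP y) => yl yu.
by rewrite !lerD ?ler_wpM2l.
Qed.

Definition mix (x y : tfn R) : tfn R := Tfn (mix_subproof x y).

Lemma cut_l_mix (x y : tfn R) (alpha : R) :
  cut_l (mix x y) alpha = (1 - t) * cut_l x alpha + t * cut_l y alpha.
Proof. by rewrite /cut_l /=; ring. Qed.

Lemma cut_u_mix (x y : tfn R) (alpha : R) :
  cut_u (mix x y) alpha = (1 - t) * cut_u x alpha + t * cut_u y alpha.
Proof. by rewrite /cut_u /=; ring. Qed.

Lemma gmir_mix (x y : tfn R) :
  gmir (mix x y) = (1 - t) * gmir x + t * gmir y.
Proof. by rewrite /gmir /=; field. Qed.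

Lemma ratio_close_mix (x1 y1 x2 y2 a eps : R) :
  ratio_close x1 y1 a eps -> ratio_close x2 y2 a eps ->
  ratio_close ((1 - t) * x1 + t * x2) ((1 - t) * y1 + t * y2) a eps.
Proof.
case/andP: ht => t0 t1.
have s0 : 0 <= 1 - t by rewrite subr_ge0.
move=> /ratio_closeE[y1_gt0 /andP[l1 u1]] /ratio_closeE[y2_gt0 /andP[l2 u2]].
apply/ratio_closeE; split.
  (* One of the coefficients [1 - t] and [t] may vanish, but not both. *)
  have [-> | t_neq0] := eqVneq t 0; first by rewrite subr0 mul1r mul0r addr0.
  apply: ltr_wpDl; first by rewrite mulr_ge0 // ltW.
  by rewrite mulr_gt0 // lt0r t_neq0.
rewrite mulrDr (mulrCA (a - eps)) (mulrCA (a - eps) t).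
rewrite mulrDr (mulrCA (a + eps)) (mulrCA (a + eps) t).
by rewrite !lerD ?ler_wpM2l.
Qed.

Lemma feasible_mix {n : nat} {b w : 'I_n} {A : fpcs R b w} {F : set R}
    {eps : R} {x y : 'I_n -> tfn R} :
  feasible A F eps x -> feasible A F eps y ->
  feasible A F eps (fun q => mix (x q) (y q)).
Proof.
move=> [xbl xbu xwl xwu xbwl xbwu x0 xs] [ybl ybu ywl ywu ybwl ybwu y0 ys].
split=> [i ib iw|i ib iw|i ib iw|i ib iw|||q|] => [alpha Fa|alpha Fa|alpha Fa
  |alpha Fa|alpha Fa|alpha Fa||]; rewrite ?cut_l_mix ?cut_u_mix.
- by apply: ratio_close_mix; [exact: xbl|exact: ybl].
- by apply: ratio_close_mix; [exact: xbu|exact: ybu].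
- by apply: ratio_close_mix; [exact: xwl|exact: ywl].
- by apply: ratio_close_mix; [exact: xwu|exact: ywu].
- by apply: ratio_close_mix; [exact: xbwl|exact: ybwl].
- by apply: ratio_close_mix; [exact: xbwu|exact: ybwu].
- by case/andP: ht => t0 t1; rewrite /= addr_ge0 ?mulr_ge0 ?subr_ge0.
- under eq_bigr do rewrite gmir_mix.
  by rewrite big_split -!mulr_sumr /= xs ys !mulr1 subrK.
Qed.

End Mix.

Lemma optimal_value_unique {R : realType} {n : nat} {b w : 'I_n}
    {A : fpcs R b w} {F : set R} {eps1 eps2 : R} :
  optimal_value A F eps1 -> optimal_value A F eps2 -> eps1 = eps2.
Proof.
move=> [[x1 f1] min1] [[x2 f2] min2].
by apply/le_anti; rewrite (min1 _ _ f2) (min2 _ _ f1).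
Qed.

Theorem theorem2 (R : realType) (n : nat) (b w : 'I_n) (hbw : b != w)
  (A : fpcs R b w) (F : set R) (hF : finite_set F)
  (hF01 : F `<=` [set alpha : R | 0 <= alpha <= 1])
  (i0 : 'I_n) (w' w'' : R)
  (hw' : defuzz_approx_optimal_weight A F i0 w')
  (hw'' : defuzz_approx_optimal_weight A F i0 w'')
  (hlt : w' < w'') (v : R) (hv : w' <= v <= w'') :
  defuzz_approx_optimal_weight A F i0 v.
Proof.
case: hw' => x [eps opt fx] ex; case: hw'' => y [eps2 opt2 fy] ey.
rewrite -(optimal_value_unique opt opt2) in fy.
have d0 : 0 < w'' - w' by rewrite subr_gt0.
pose t := (v - w') / (w'' - w').
have ht : 0 <= t <= 1.
  case/andP: hv => v1 v2.
  by rewrite divr_ge0 ?subr_ge0 ?(ltW hlt) //= ler_pdivrMr // mul1r lerD2r.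
exists (fun q => mix ht (x q) (y q)).
  by exists eps => //; exact: feasible_mix.
rewrite gmir_mix -ex -ey /t; field.
exact: lt0r_neq0.
Qed.
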